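(* Consider two one-dimensional SDEs driven by the same Wiener process, $$dX_t=\nu(t,X_t)\,dt+\sigma(t,X_t)\,dW_t,\qquad dY_t=\lambda(t,Y_t)\,dt+\sigma(t,Y_t)\,dW_t,$$ and suppose that: (i) $\nu,\lambda,\sigma$ are continuous in $x$; (ii) the solutions $X_t$ and $Y_t$ exist and are unique; (iii) $X_0\le Y_0$ a.s.; (iv) $\nu(t,x)\le\lambda(t,x)$ for all $t\ge0$, $x\in\mathbb R$; (v) $\lambda$ satisfies the one-sided Lipschitz condition $(x-y)(\lambda(t,x)-\lambda(t,y))\le K|x-y|^2$ for all $t\ge 0$, $x,y\in\mathbb R$, for some $K$. Suppose there is a taming method such that, for some $\mu,\alpha>0$ (independent of $h$), $$|\lambda^h(t,x)-\lambda^h(t,y)|\,h^\alpha\vee|\sigma^h(t,x)-\sigma^h(t,y)|\,h^{\alpha/2}\le\mu|x-y|,\qquad\forall x,y\in\mathbb R,\ t\ge0,$$ and $$\nu^h(t,x)\le\lambda^h(t,x),\qquad\forall t\ge0,\ x\in\mathbb R.$$ Then, if $\alpha<1$ and $h$ is sufficiently small, the tamed Euler schemes $$\bar X_{k+1}=\bar X_k+\nu^h(t_k,\bar X_k)h+\sigma^h(t_k,\bar X_k)\sqrt h\,\zeta_h,\qquad \bar Y_{k+1}=\bar Y_k+\lambda^h(t_k,\bar Y_k)h+\sigma^h(t_k,\bar Y_k)\sqrt h\,\zeta_h,$$ with $\bar X_0=X_0$, $\bar Y_0=Y_0$, preserve the comparison result: $\bar X_k\le\bar Y_k$ a.s. for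 all $k\ge0$.
   Context: $W$ is a one-dimensional Wiener process. $h>0$ is the step size and $t_k=kh$. For each $h$, $\nu^h,\lambda^h,\sigma^h:[0,\infty)\times\mathbb R\to\mathbb R$ are tamed versions of $\nu,\lambda,\sigma$ (measurable functions). In each step, $\zeta_h$ denotes the truncation of a fresh standard normal variable $\xi\sim N(0,1)$: $\zeta_h=A_h$ if $\xi>A_h$, $\zeta_h=\xi$ if $-A_h\le\xi\le A_h$, $\zeta_h=-A_h$ if $\xi<-A_h$, where $A_h=\sqrt{2|\log h|}$. The same $\zeta_h$ is used in both schemes at each step. $a\vee b=\max(a,b)$. *)

(* Defs.v *)
From HB Require Import structures.
From mathcomp Require Import all_boot all_order all_algebra.
From mathcomp Require Import all_classical all_reals all_analysis.

Set Implicit Arguments.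
Unset Strict Implicit.
Unset Printing Implicit Defensive.

Import Order.TTheory GRing.Theory Num.Theory.
Import numFieldNormedType.Exports.

Local Open Scope classical_set_scope.
Local Open Scope ring_scope.

(* Time-dependent objects are indexed by all of R, but only their values at
   times t >= 0 are ever constrained. *)

Section sub_sigma_algebras.
Context d (T : measurableType d) (R : realType).

Definition measurable_wrt (G : set (set T)) (f : T -> R) : Prop :=
  forall B : set R, measurable B -> G (f @^-1` B).

Definition sigma_generated_by (fs : set (T -> R)) : set (set T) :=
  <<s [set A | exists f B, [/\ fs f, measurable B & A = f @^-1` B]] >>.

Definition independent_of (P : probability T R) (f : T -> R)
    (G : set (set T)) : Prop :=
  forall (A : set T) (B : set R), G A -> measurable B ->
    P (A `&` f @^-1` B) = (P A * P (f @^-1` B))%E.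

Definition has_normal_law (P : probability T R) (f : T -> R) (m s : R) : Prop :=
  measurable_fun setT f /\
  forall B : set R, measurable B -> pushforward P f B = normal_prob m s B.

Definition cvg_in_prob0 (P : probability T R) (Z : nat -> T -> \bar R) : Prop :=
  forall e : R, 0 < e -> P [set w | (e%:E <= Z n w)%E] @[n --> \oo] --> 0%E.

End sub_sigma_algebras.

Section stochastic_calculus.
Context d (T : measurableType d) (R : realType) (P : probability T R).

Record is_filtration (F : R -> set (set T)) : Prop := {
  filtration_sigma : forall t, 0 <= t -> sigma_algebra setT (F t) ;
  filtration_measurable : forall t, 0 <= t -> F t `<=` measurable ;
  filtration_nondecreasing : forall s t, 0 <= s -> s <= t -> F s `<=` F t }.

Definition adapted (F : R -> set (set T)) (H : R -> T -> R) : Prop :=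
  forall t, 0 <= t -> measurable_wrt (F t) (H t).

Definition continuous_paths (H : R -> T -> R) : Prop :=
  {ae P, forall w, {within [set t | 0 <= t], continuous (H ^~ w)}}.

(* For every t, H is measurable on [0, t] x T for the product of the Borel
   sigma-algebra and F t. *)
Definition progressive (F : R -> set (set T)) (H : R -> T -> R) : Prop :=
  forall (t : R) (B : set R), 0 <= t -> measurable B ->
    <<s [set C : set (R * T) | exists A E,
          [/\ measurable A, F t E & C = A `*` E]] >>
      [set p | 0 <= p.1 <= t /\ B (H p.1 p.2)].

Record is_wiener (F : R -> set (set T)) (W : R -> T -> R) : Prop := {
  wiener0 : {ae P, forall w, W 0 w = 0} ;
  wiener_adapted : adapted F W ;
  wiener_normal : forall s t, 0 <= s -> s < t ->
    has_normal_law P (fun w => W t w - W s w) 0 (Num.sqrt (t - s)) ;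
  wiener_independent : forall s t, 0 <= s -> s < t ->
    independent_of P (fun w => W t w - W s w) (F s) ;
  wiener_continuous : continuous_paths W }.

(* The process  sum_(j < n) eta_j 1_(]t_j, t_(j+1)]). *)
Record simple_process := SimpleProcess {
  sp_size : nat ;
  sp_time : nat -> R ;
  sp_coef : nat -> T -> R }.

Definition simple_adapted (F : R -> set (set T)) (S : simple_process) : Prop :=
  [/\ forall j, 0 <= sp_time S j,
      forall j, sp_time S j <= sp_time S j.+1,
      forall j, measurable_wrt (F (sp_time S j)) (sp_coef S j) &
      exists M : R, forall j w, `|sp_coef S j w| <= M].

Definition simple_value (S : simple_process) (s : R) (w : T) : R :=
  \sum_(j < sp_size S) sp_coef S j w * ((sp_time S j < s <= sp_time S j.+1)%R)%:R.

Definition simple_integral (W : R -> T -> R) (S : simple_process)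
    (t : R) (w : T) : R :=
  \sum_(j < sp_size S) sp_coef S j w *
    (W (Num.min (sp_time S j.+1) t) w - W (Num.min (sp_time S j) t) w).

(* I_t = int_0^t H_s dW_s for all t >= 0: the Ito integral of a progressive
   integrand with int_0^t H_s^2 ds < oo a.s., as the limit in probability of
   integrals of simple processes.  This determines I up to
   indistinguishability. *)
Record is_ito_integral (F : R -> set (set T)) (W H I : R -> T -> R) : Prop := {
  ito_progressive : progressive F H ;
  ito_square_integrable : {ae P, forall w, forall t, 0 <= t ->
    (\int[lebesgue_measure]_(s in `[0%R, t]) ((H s w) ^+ 2)%:E < +oo)%E} ;
  ito_measurable : forall t, 0 <= t -> measurable_fun setT (I t) ;
  ito_continuous : continuous_paths I ;
  ito_limit : exists S : nat -> simple_process,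
    (forall n, simple_adapted F (S n)) /\
    forall t, 0 <= t ->
      cvg_in_prob0 P (fun n w => \int[lebesgue_measure]_(s in `[0%R, t])
        ((simple_value (S n) s w - H s w) ^+ 2)%:E)%E /\
      cvg_in_prob0 P (fun n w => `|simple_integral W (S n) t w - I t w|%:E) }.

(* X is a (global, strong) solution of dX_t = b(t, X_t) dt + s(t, X_t) dW_t. *)
Definition is_sde_solution (F : R -> set (set T)) (W : R -> T -> R)
    (b s : R -> R -> R) (X : R -> T -> R) : Prop :=
  [/\ adapted F X, continuous_paths X,
      progressive F (fun t w => b t (X t w)) &
      exists I : R -> T -> R,
        is_ito_integral F W (fun t w => s t (X t w)) I /\
        {ae P, forall w, forall t, 0 <= t ->
          lebesgue_measure.-integrable `[0, t]
            (fun u => (b u (X u w))%:E) /\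
          X t w = X 0 w
            + Rintegral lebesgue_measure `[0, t] (fun u => b u (X u w))
            + I t w}].

(* Uniqueness is pathwise, among solutions with the initial value of X. *)
Definition is_unique_sde_solution (F : R -> set (set T)) (W : R -> T -> R)
    (b s : R -> R -> R) (X : R -> T -> R) : Prop :=
  is_sde_solution F W b s X /\
  forall X' : R -> T -> R, is_sde_solution F W b s X' ->
    {ae P, forall w, X' 0 w = X 0 w} ->
    {ae P, forall w, forall t, 0 <= t -> X' t w = X t w}.

(* xi k is a standard normal variable, independent of the variables in init
   and of the earlier xi j. *)
Definition fresh_std_normals (init : set (T -> R)) (xi : nat -> T -> R) : Prop :=
  forall k, has_normal_law P (xi k) 0 1 /\
    independent_of P (xi k)
      (sigma_generated_by (init `|` [set xi j | j in [set j | (j < k)%N]])).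

End stochastic_calculus.

Section tamed_euler.
Context (R : realType).

Definition truncation_level (h : R) : R := Num.sqrt (2 * `|ln h|).

Definition truncate (A x : R) : R :=
  if A < x then A else if x < - A then - A else x.

Fixpoint tamed_euler (T : Type) (h : R) (b s : R -> R -> R)
    (xi : nat -> T -> R) (x0 : T -> R) (k : nat) (w : T) : R :=
  if k is j.+1 then
    let x := tamed_euler h b s xi x0 j w in
    let t := j%:R * h in
    x + b t x * h
      + s t x * Num.sqrt h * truncate (truncation_level h) (xi j w)
  else x0 w.

End tamed_euler.

(* Main.v *)
(** The comparison holds path by path, by induction on [k].  With
    [b := (1 - alpha) / 2], one step changes the gap [y - x >= 0] by at least
    [- mu (y - x) (h^(2 b) + h^b A_h)], since the drift increment is at most
    [mu (y - x) h^(1 - alpha)] and the truncated noise is at most [A_h] in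
    absolute value.  As [h^b |ln h| <= 1 / b], the factor
    [mu (h^(2 b) + h^b A_h)] tends to [0] with [h], so it is at most [1] for small
    [h] and the gap stays nonnegative. *)

Require Import Defs.
From HB Require Import structures.
From mathcomp Require Import all_boot all_order all_algebra.
From mathcomp Require Import ring lra.
From mathcomp Require Import all_classical all_reals all_analysis.
Import Order.TTheory GRing.Theory Num.Theory.
Import numFieldNormedType.Exports.
Local Open Scope classical_set_scope.
Local Open Scope ring_scope.

Section step_size.
Context {R : realType}.
Implicit Types (h mu b A x : R).

Lemma truncate_norm_le A x : 0 <= A -> `|truncate A x| <= A.
Proof.
move=> A0; rewrite /truncate; case: ltP => [_|xA]; first by rewrite ger0_norm.
case: ltP => [_|Ax]; first by rewrite normrN ger0_norm.
by rewrite ler_norml Ax.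
Qed.

(** The inequality [ln u <= u - 1] at [u = h^(-b)] gives [b |ln h| <= h^(-b) - 1]; multiplying by
    [h^b] leaves a right side below [1]. *)
Lemma powR_mul_normr_ln_le b h : 0 < b -> 0 < h -> h < 1 ->
  h `^ b * `|ln h| <= b^-1.
Proof.
move=> b0 h0 h1.
have e0 : 0 < h `^ b by exact: powR_gt0.
have lnN : ln h < 0 by rewrite ln_lt0 // h0.
have := @le_ln1Dx R ((h `^ b)^-1 - 1).
rewrite [1 + _]addrC subrK lnV ?posrE// ln_powR ltrBrDl subrr invr_gt0 e0 => /(_ isT) le1.
rewrite ltr0_norm // -[leRHS]mulr1 ler_pdivlMl //.
have: h `^ b * - (b * ln h) <= h `^ b * (h `^ b)^-1.
  by rewrite ler_pM2l //; lra.
rewrite mulfV ?gt_eqF// => H; lra.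
Qed.

(* Squaring the noise term leaves one spare factor [h `^ b] after the logarithm
   has absorbed the other. *)
Lemma step_size_small mu b : 0 < mu -> 0 < b ->
  exists2 h0 : R, 0 < h0 & forall h, 0 < h -> h < h0 ->
    mu * h `^ b ^+ 2 + mu * h `^ b * truncation_level h <= 1.
Proof.
move=> mu0 b0.
(* With [e = h^b], the bounds [e <= 1] and [e <= 1 / (2 mu)] make the drift term at most [1/2];
   [e <= b / (8 mu^2)] makes the squared noise term, at most [2 mu^2 e / b], no larger than
   [1/4]. *)
pose c := Num.min 1 (Num.min (b / (8 * mu ^+ 2)) (2 * mu)^-1).
have c0 : 0 < c.
  by rewrite !lt_min ltr01 divr_gt0 ?invr_gt0 ?mulr_gt0 ?exprn_gt0.
exists (Num.min 1 (c `^ b^-1)); first by rewrite lt_min ltr01 powR_gt0.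
move=> h h0; rewrite lt_min => /andP[h1 hc].
have e0 : 0 < h `^ b by exact: powR_gt0.
have : h `^ b <= c.
  rewrite -[leRHS]powRr1 ?(ltW c0)// -(mulVf (lt0r_neq0 b0)) powRrM.
  by rewrite (ge0_ler_powR (ltW b0)) ?nnegrE ?powR_ge0 ?(ltW h0) ?(ltW hc).
rewrite !le_min => /and3P[e1 eb emu].
have drift : mu * h `^ b ^+ 2 <= 2^-1.
  have : mu * h `^ b <= 2^-1.
    rewrite invfM in emu.
    by rewrite mulrC -ler_pdivlMr.
  move=> H; rewrite expr2; nra.
have noise : mu * h `^ b * truncation_level h <= 2^-1.
  rewrite -(@ler_pXn2r _ 2) // ?nnegrE ?invr_ge0 ?mulr_ge0 ?sqrtr_ge0 ?(ltW mu0) ?(ltW e0)//.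
  rewrite exprMn /truncation_level sqr_sqrtr ?mulr_ge0//.
  have L := powR_mul_normr_ln_le _ _ b0 h0 h1.
  have : 2 * mu ^+ 2 * h `^ b * (h `^ b * `|ln h|) <= 2 * mu ^+ 2 * h `^ b * b^-1.
    by apply: ler_wpM2l L; rewrite !mulr_ge0 ?exprn_ge0 ?(ltW mu0) ?(ltW e0).
  have : h `^ b * (8 * mu ^+ 2) * b^-1 <= 1.
    rewrite ler_pdivrMr // mul1r -ler_pdivlMr // mulr_gt0 // exprn_gt0 //.
  move=> H1 H2; rewrite exprMn; lra.
lra.
Qed.

(* [q] and [r] are the increments, from [x] to [y], of the tamed drift and
   diffusion coefficients. *)
Lemma euler_step_le (x y q r h mu alpha A z : R) : 0 < h -> x <= y ->
  `|q| * h `^ alpha <= mu * `|y - x| ->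
  `|r| * h `^ (alpha / 2) <= mu * `|y - x| ->
  `|z| <= A ->
  mu * h `^ ((1 - alpha) / 2) ^+ 2 + mu * h `^ ((1 - alpha) / 2) * A <= 1 ->
  0 <= y - x + q * h + r * Num.sqrt h * z.
Proof.
move=> h0 xy; rewrite (@ger0_norm _ (y - x)) ?subr_ge0// => Hq Hr zA Hs.
set e := h `^ ((1 - alpha) / 2) in Hs *.
have e0 : 0 <= e by exact: powR_ge0.
(* The step factors split as [h = h^alpha e^2] and [sqrt h = h^(alpha/2) e]: the first factors are
   absorbed by the taming bounds, and the powers of [e] remain as the small factors. *)
have Eh : h `^ alpha * e ^+ 2 = h.
  rewrite expr2 -!powRD; try by rewrite (gt_eqF h0) implybT.
  by rewrite (_ : alpha + _ = 1) ?powRr1 ?ltW//; field.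
have Es : h `^ (alpha / 2) * e = Num.sqrt h.
  rewrite -powRD; last by rewrite (gt_eqF h0) implybT.
  by rewrite (_ : alpha / 2 + _ = 2^-1) ?powR12_sqrt ?ltW//; field.
have A0 : 0 <= A by exact: le_trans zA.
have drift : `|q * h| <= mu * (y - x) * e ^+ 2.
  rewrite normrM (gtr0_norm h0) -[in leLHS]Eh mulrA.
  by rewrite ler_wpM2r ?exprn_ge0.
have noise : `|r * Num.sqrt h * z| <= mu * (y - x) * e * A.
  rewrite !normrM (ger0_norm (sqrtr_ge0 h)) -Es mulrA.
  by rewrite ler_pM ?mulr_ge0 ?powR_ge0// ler_wpM2r.
(* Scaled by the gap, the smallness hypothesis says that drift and noise together cannot exceed the
   gap. *)
have : (y - x) * (mu * e ^+ 2 + mu * e * A) <= (y - x) * 1.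
  by rewrite ler_wpM2l ?subr_ge0.
move: drift noise; rewrite !ler_norml => /andP[d1 _] /andP[n1 _] H; lra.
Qed.

Lemma tamed_euler_le (T : Type) (h mu alpha : R) (b1 b2 s : R -> R -> R)
    (xi : nat -> T -> R) (x0 y0 : T -> R) (w : T) :
  0 < h ->
  (forall t x y, 0 <= t ->
    Num.max (`|b2 t x - b2 t y| * h `^ alpha)
            (`|s t x - s t y| * h `^ (alpha / 2)) <= mu * `|x - y|) ->
  (forall t x, 0 <= t -> b1 t x <= b2 t x) ->
  mu * h `^ ((1 - alpha) / 2) ^+ 2
    + mu * h `^ ((1 - alpha) / 2) * truncation_level h <= 1 ->
  x0 w <= y0 w ->
  forall k, tamed_euler h b1 s xi x0 k w <= tamed_euler h b2 s xi y0 k w.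
Proof.
move=> h0 lip b12 small xy0; elim=> [//|k IH] /=.
set x := tamed_euler _ _ _ _ x0 k w in IH *.
set y := tamed_euler _ _ _ _ y0 k w in IH *.
set z := truncate _ _; set t := k%:R * h.
have t0 : 0 <= t by rewrite mulr_ge0 ?ler0n ?(ltW h0).
have := lip t y x t0; rewrite ge_max => /andP[Hb Hs].
have zA : `|z| <= truncation_level h by rewrite truncate_norm_le ?sqrtr_ge0.
have step := euler_step_le _ _ _ _ _ _ _ _ _ h0 IH Hb Hs zA small.
(* The drift gap [b2 t y - b1 t x] is [b2 t y - b2 t x], covered by [step], plus the nonnegative
   [b2 t x - b1 t x]. The noise [z] is common to both schemes, so only the increment of [s]
   multiplies it. *)
have : b1 t x * h <= b2 t x * h by rewrite ler_pM2r ?b12.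
lra.
Qed.

End step_size.

Theorem theorem4p3 (R : realType) (d : measure_display) (T : measurableType d)
    (P : probability T R) (F : R -> set (set T)) (W : R -> T -> R)
    (nu lambda sigma : R -> R -> R) (X Y : R -> T -> R) (K : R)
    (nuh lambdah sigmah : R -> R -> R -> R) (mu alpha : R) :
  is_filtration F -> is_wiener P F W ->
  (forall t, 0 <= t ->
    [/\ continuous (nu t), continuous (lambda t) & continuous (sigma t)]) ->
  is_unique_sde_solution P F W nu sigma X ->
  is_unique_sde_solution P F W lambda sigma Y ->
  {ae P, forall w, X 0 w <= Y 0 w} ->
  (forall t x, 0 <= t -> nu t x <= lambda t x) ->
  (forall t x y, 0 <= t ->
    (x - y) * (lambda t x - lambda t y) <= K * `|x - y| ^+ 2) ->
  (forall h, 0 < h ->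
    [/\ measurable_fun [set p : R * R | 0 <= p.1] (fun p => nuh h p.1 p.2),
        measurable_fun [set p : R * R | 0 <= p.1] (fun p => lambdah h p.1 p.2) &
        measurable_fun [set p : R * R | 0 <= p.1] (fun p => sigmah h p.1 p.2)]) ->
  0 < mu -> 0 < alpha ->
  (forall h t x y, 0 < h -> 0 <= t ->
    Num.max (`|lambdah h t x - lambdah h t y| * h `^ alpha)
            (`|sigmah h t x - sigmah h t y| * h `^ (alpha / 2))
      <= mu * `|x - y|) ->
  (forall h t x, 0 < h -> 0 <= t -> nuh h t x <= lambdah h t x) ->
  alpha < 1 ->
  exists2 h0 : R, 0 < h0 &
    forall h, 0 < h -> h < h0 ->
    forall xi : nat -> T -> R, fresh_std_normals P [set X 0; Y 0] xi ->
    forall k : nat, {ae P, forall w,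
      tamed_euler h (nuh h) (sigmah h) xi (X 0) k w
        <= tamed_euler h (lambdah h) (sigmah h) xi (Y 0) k w}.
Proof.
move=> _ _ _ _ _ XY0 _ _ _ mu0 _ lip nu_le alpha1.
have b0 : 0 < (1 - alpha) / 2 by rewrite divr_gt0 // subr_gt0.
(* This threshold depends only on [mu] and [alpha], hence neither on the noise nor on [k]. *)
have [h0 h00 small] := step_size_small _ _ mu0 b0.
exists h0 => // h hpos hh0 xi _ k.
(* The only exceptional paths are those with [X 0 w > Y 0 w], whatever [k] is. *)
apply: filterS XY0 => w XY0w.
apply: (tamed_euler_le _ _ _ _ _ _ _ xi _ _ _ hpos) XY0w k.
- by move=> t x y; exact: lip.
- by move=> t x; exact: nu_le.
- exact: small.
Qed.
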